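(* Consider a two-layer multilayer network game with intra-layer matrices $G^{(1)},G^{(2)}\in\mathbb{R}^{N\times N}$ (zero diagonals) and inter-layer matrices $G^{(12)},G^{(21)}\in\mathbb{R}^{N\times N}$, and suppose it is one-way, i.e., $G^{(12)}=\mathbf{0}$ or $G^{(21)}=\mathbf{0}$. Then the multilayer network game is guaranteed to have a unique Nash equilibrium if and only if the constituent layers are guaranteed to have unique Nash equilibria, i.e., if and only if $I+G^{(1)}$ and $I+G^{(2)}$ are both P-matrices.
   Context: A square real matrix is a P-matrix if all its principal minors are strictly positive. Multilayer network game: there are $N$ agents; agent $i$ chooses an effort $x_i^{(l)}\in\mathbb{R}_{\geq0}$ in each layer $l\in\{1,2\}$. Entries of $G^{(l)}$ and of the inter-layer matrices $G^{(lk)}$ have arbitrary sign. Agent $i$'s utility from layer $l$ (with $k$ the other layer) is $$u_i^{(l)}=b_i^{(l)}\Bigl(x_i^{(l)}+\sum_{j=1}^N g^{(l)}_{ij}x_j^{(l)}+\sum_{j=1}^N g^{(lk)}_{ij}x_j^{(k)}\Bigr)-c_i^{(l)}x_i^{(l)},$$ and its total utility is $\kappa u_i^{(1)}+(1-\kappa)u_i^{(2)}$. Each benefit function $b_i^{(l)}:\mathbb{R}\to\mathbb{R}$ is twice differentiable, strictly increasing and strictly concave, $c_i^{(l)}>0$, and it is assumed that there is a (necessarily unique) $q_i^{(l)}\in\mathbb{R}$ with $(b_i^{(l)})'(q_i^{(l)})=c_i^{(l)}$. Nash equilibria of the game are the solutions of the linear best-reply system: vectors $\mathbf{x}^*=(\mathbf{x}^{*(1)},\mathbf{x}^{*(2)})\in\mathbb{R}^{2N}_{\geq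 0}$ with $\mathbf{x}^*=\max\{\mathbf{0},\,\mathbf{q}-\mathbf{G}\mathbf{x}^*\}$ componentwise, where $\mathbf{q}=(\mathbf{q}^{(1)},\mathbf{q}^{(2)})$ and $\mathbf{G}=\begin{pmatrix} G^{(1)} & G^{(12)} \\ G^{(21)} & G^{(2)} \end{pmatrix}$. ''Guaranteed to have a unique Nash equilibrium'' means: for all admissible benefit functions and unit costs there is exactly one Nash equilibrium. The game on layer $l$ by itself is the game whose equilibria are $\mathbf{x}\in\mathbb{R}^N_{\ge0}$ with $\mathbf{x}=\max\{\mathbf 0,\mathbf{q}^{(l)}-G^{(l)}\mathbf{x}\}$. *)

(* Defs.v *)
From mathcomp Require Import all_boot all_order all_algebra.
From mathcomp Require Import all_classical all_reals all_analysis.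
Import Order.TTheory GRing.Theory Num.Theory.
Import numFieldNormedType.Exports.

Set Implicit Arguments.
Unset Strict Implicit.
Unset Printing Implicit Defensive.

Local Open Scope classical_set_scope.
Local Open Scope ring_scope.

Definition principal_minor (R : realType) (n : nat) (A : 'M[R]_n)
    (J : {set 'I_n}) : R :=
  \det (mxsub (fun k : 'I_#|J| => enum_val k)
              (fun k : 'I_#|J| => enum_val k) A).

(* [J] may be empty; the corresponding minor is then [1], so this adds no
   constraint. *)
Definition P_matrix (R : realType) (n : nat) (A : 'M[R]_n) : Prop :=
  forall J : {set 'I_n}, 0 < principal_minor A J.

Definition twice_differentiable (R : realType) (b : R -> R) : Prop :=
  (forall t : R, derivable b t 1) /\ (forall t : R, derivable (derive1 b) t 1).

Definition strictly_increasing (R : realType) (b : R -> R) : Prop :=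
  forall s t : R, s < t -> b s < b t.

Definition strictly_concave (R : realType) (b : R -> R) : Prop :=
  forall s t a : R, s != t -> 0 < a -> a < 1 ->
    a * b s + (1 - a) * b t < b (a * s + (1 - a) * t).

Definition admissible (R : realType) (b : R -> R) (c : R) : Prop :=
  [/\ twice_differentiable b, strictly_increasing b, strictly_concave b,
      0 < c & exists q : R, derive1 b q = c].

(* The solution of [b' q = c]: it exists when [b] and [c] are admissible, and
   is then unique because the derivative of a strictly concave function is
   injective. The default value 0 is never used for admissible data. *)
Definition target (R : realType) (b : R -> R) (c : R) : R :=
  xget 0 [set q : R | derive1 b q = c].

Definition target_vector (R : realType) (n : nat)
    (b : 'I_n -> R -> R) (c : 'I_n -> R) : 'cV[R]_n :=
  \col_i target (b i) (c i).

(* Equilibria are the solutions of the linear best-reply system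
   x = max (0, q - G x) with x >= 0; the utilities enter only through the
   targets q, and the weight of the layers in an agent's total utility does
   not enter at all. *)
Definition nash_equilibrium (R : realType) (n : nat) (G : 'M[R]_n)
    (q x : 'cV[R]_n) : Prop :=
  (forall i, 0 <= x i 0) /\ x = map2_mx Num.max 0 (q - G *m x).

Definition layer_guaranteed_unique_nash (R : realType) (N : nat)
    (G : 'M[R]_N) : Prop :=
  forall (b : 'I_N -> R -> R) (c : 'I_N -> R),
    (forall i, admissible (b i) (c i)) ->
    exists! x : 'cV[R]_N, nash_equilibrium G (target_vector b c) x.

(* Efforts are stacked as (x1, x2), the first block being layer 1. *)
Definition multilayer_guaranteed_unique_nash (R : realType) (N : nat)
    (G1 G12 G21 G2 : 'M[R]_N) : Prop :=
  forall (b1 b2 : 'I_N -> R -> R) (c1 c2 : 'I_N -> R),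
    (forall i, admissible (b1 i) (c1 i)) ->
    (forall i, admissible (b2 i) (c2 i)) ->
    exists! x : 'cV[R]_(N + N),
      nash_equilibrium (block_mx G1 G12 G21 G2)
        (col_mx (target_vector b1 c1) (target_vector b2 c2)) x.

(* Main.v *)
Require Import Defs.
From mathcomp Require Import all_boot all_order all_algebra.
From mathcomp Require Import all_classical all_reals all_analysis.
From mathcomp Require Import fingroup perm ring lra.
Import Order.TTheory GRing.Theory Num.Theory.
Import numFieldNormedType.Exports.
Local Open Scope ring_scope.

(** Equilibria on a layer are the solutions of the linear complementarity
    problem of M = I + G, and every vector of targets is realised by benefit
    functions t |-> - exp (q - t) at unit cost. A matrix is a P-matrix if and
    only if it reverses the sign of no nonzero vector z, i.e. z_i (M z)_i <= 0
    for all i forces z = 0. Such matrices are those whose complementarity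
    problem is always uniquely solvable: the difference of two solutions has
    its sign reversed, and conversely a reversed z yields the two solutions
    z^+ and z^- of a single problem. In the one-way game the leading layer is
    solved first and only shifts the targets of the other one. *)

Set Implicit Arguments.
Unset Strict Implicit.
Unset Printing Implicit Defensive.

Definition no_sign_reversal (R : realType) n (M : 'M[R]_n) : Prop :=
  forall z : 'cV_n, (forall i, z i 0 * (M *m z) i 0 <= 0) -> z = 0.

(* The constant term enters with the sign opposite to the usual one, so that
   [q] is the vector of targets: the slack is [M x - q]. *)
Definition lcp (R : realType) n (M : 'M[R]_n) (q x : 'cV_n) : Prop :=
  forall i, [/\ 0 <= x i 0, q i 0 <= (M *m x) i 0 &
                x i 0 * ((M *m x) i 0 - q i 0) = 0].

(** * Principal minors and sign reversal *)

Lemma det_neq0_ker (F : fieldType) n (A : 'M[F]_n) :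
  (forall x : 'cV_n, A *m x = 0 -> x = 0) <-> \det A != 0.
Proof.
split=> [kerA | detA x Ax0].
  rewrite -det_tr; apply/det0P => -[v v0 vA].
  case/negP: v0; rewrite -[v]trmxK (kerA v^T) ?trmx0 //.
  by apply: trmx_inj; rewrite trmx_mul trmxK trmx0.
have Au : A \in unitmx by rewrite unitmxE unitfE.
by rewrite -(mulKmx Au x) Ax0 mulmx0.
Qed.

Section Minors.
Variable (R : realType).

(** Two enumerations of one index set differ by a permutation, which acts on both rows and columns,
    so its sign cancels. *)
Lemma det_mxsub_same_image n k (M : 'M[R]_n) (f g : 'I_k -> 'I_n) :
  injective f -> injective g -> (forall i, f i \in codom g) ->
  \det (mxsub f f M) = \det (mxsub g g M).
Proof.
move=> fI gI fg; pose s0 i := iinv (fg i).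
have gs i : g (s0 i) = f i by exact: f_iinv.
have sI : injective s0 by move=> i j /(congr1 g); rewrite !gs => /fI.
pose s := perm sI.
have -> : mxsub f f M = row_perm s (col_perm s (mxsub g g M)).
  by apply/matrixP=> i j; rewrite !mxE !permE !gs.
rewrite row_permE col_permE !det_mulmx !det_perm.
by rewrite mulrCA odd_permV -signr_addb addbb mulr1.
Qed.

(* Positivity of the principal minors in a form stable under reindexing. *)
Definition inj_minors_gt0 n (M : 'M[R]_n) : Prop :=
  forall k (f : 'I_k -> 'I_n), injective f -> 0 < \det (mxsub f f M).

Lemma P_matrix_inj_minors n (M : 'M[R]_n) : P_matrix M -> inj_minors_gt0 M.
Proof.
move=> PM k f fI; pose J := [set x in codom f].
have cJ : #|J| = k by rewrite cardsE card_codom // card_ord.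
(* Abstracting the size [m] allows the equality [#|J| = k] to be eliminated although the matrix
   types depend on it. *)
have transfer m (h : 'I_m -> 'I_n) : m = k -> injective h ->
    (forall i, f i \in codom h) -> \det (mxsub f f M) = \det (mxsub h h M).
  by move=> mk; case: _ / (esym mk) h => h; apply: det_mxsub_same_image.
rewrite (transfer _ _ cJ (@enum_val_inj _ (mem J))); first exact: PM.
move=> i; have fJ : f i \in J by rewrite inE codom_f.
by rewrite -(enum_rankK_in fJ fJ); apply: codom_f.
Qed.

(** The cofactors along row [j] do not involve the changed entry. *)
Lemma det_add_diag n (B : 'M[R]_n) j d :
  \det (B + d *: delta_mx j j) = \det B + d * cofactor B j j.
Proof.
rewrite (expand_det_row _ j) [in RHS](expand_det_row _ j).
have cE k : cofactor (B + d *: delta_mx j j) j k = cofactor B j k.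
  congr (_ * \det _); apply/matrixP=> a b; rewrite !mxE.
  by rewrite [lift j a == j]eq_sym (negPf (neq_lift _ _)) mulr0 addr0.
under eq_bigr => k _ do rewrite cE !mxE eqxx /= mulrDl.
rewrite big_split /=; congr (_ + _).
rewrite (bigD1 j) //= eqxx mulr1 big1 ?addr0 // => k /negPf ->.
by rewrite mulr0 mul0r.
Qed.

(** A minor through [i] increases by [d] times a cofactor that is itself a principal minor; the
    others do not change. *)
Lemma inj_minors_add_diag n (M : 'M[R]_n) i d :
  0 <= d -> inj_minors_gt0 M -> inj_minors_gt0 (M + d *: delta_mx i i).
Proof.
move=> d0 PM k f fI.
case: (pickP (fun j => f j == i)) => [j /eqP fj | nf]; last first.
  have -> : mxsub f f (M + d *: delta_mx i i) = mxsub f f M; last exact: PM.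
  by apply/matrixP=> a b; rewrite !mxE nf mulr0 addr0.
have -> : mxsub f f (M + d *: delta_mx i i) = mxsub f f M + d *: delta_mx j j.
  by apply/matrixP=> a b; rewrite !mxE -fj !(inj_eq fI).
rewrite det_add_diag ltr_wpDr ?PM // mulr_ge0 // /cofactor.
rewrite addnn -signr_odd odd_double mul1r ltW //.
have -> : row' j (col' j (mxsub f f M))
    = mxsub (fun a => f (lift j a)) (fun a => f (lift j a)) M.
  by apply/matrixP=> a b; rewrite !mxE.
by apply: PM => a b /fI /lift_inj.
Qed.

Lemma inj_minors_diag_det n (M : 'M[R]_n) (d : 'rV_n) :
  (forall i, 0 <= d 0 i) -> inj_minors_gt0 M -> 0 < \det (M + diag_mx d).
Proof.
move=> d0 PM.
have : inj_minors_gt0 (M + diag_mx d).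
  rewrite diag_mx_sum_delta; elim: (index_enum _) => [|i s IH].
    by rewrite big_nil addr0.
  by rewrite big_cons addrCA addrC; apply: inj_minors_add_diag.
by move=> /(_ n id (@inj_id _)); rewrite mxsub_id.
Qed.

(* On the support of a reversed [z], [M z = - d z] with [d >= 0]; but adding [d]
   to the diagonal keeps the minor positive. *)
Lemma P_matrix_no_sign_reversal n (M : 'M[R]_n) :
  P_matrix M -> no_sign_reversal M.
Proof.
move=> PM z zM; pose J := [set i | z i 0 != 0].
pose f (k : 'I_#|J|) := enum_val k.
have zf k : z (f k) 0 != 0 by have := enum_valP k; rewrite inE.
pose B := mxsub f f M; pose x : 'cV_#|J| := \col_k z (f k) 0.
have BxE k : (B *m x) k 0 = (M *m z) (f k) 0.
  transitivity (\sum_(j in J) M (f k) j * z j 0).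
    by rewrite big_enum_val mxE; apply: eq_bigr => j _; rewrite !mxE.
  rewrite mxE [RHS](bigID (mem J)) /= [X in _ + X]big1 ?addr0 // => j.
  by rewrite inE negbK => /eqP ->; rewrite mulr0.
(* [d] is chosen so that [x] lies in the kernel of [B + diag_mx d]. *)
pose d : 'rV_#|J| := \row_k - ((M *m z) (f k) 0 / z (f k) 0).
have d0 k : 0 <= d 0 k.
  rewrite mxE oppr_ge0 -(pmulr_rle0 _ (_ : 0 < z (f k) 0 ^+ 2)); last first.
    by rewrite exprn_even_gt0 //= zf.
  by have -> : z (f k) 0 ^+ 2 * ((M *m z) (f k) 0 / z (f k) 0)
      = z (f k) 0 * (M *m z) (f k) 0 by have := zf k => ?; field.
have BP : inj_minors_gt0 B.
  move=> m g gI; rewrite /B -mxsub_comp.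
  by apply: P_matrix_inj_minors => // a b /= /enum_val_inj /gI.
have /lt0r_neq0 /det_neq0_ker ker := inj_minors_diag_det d0 BP.
have x0 : x = 0.
  apply: ker; rewrite mulmxDl; apply/colP=> k.
  rewrite mxE BxE mul_diag_mx !mxE; have := zf k => ?; field.
  by [].
apply/colP=> i; rewrite mxE; apply/eqP; apply: contraT => zi.
have iJ : i \in J by rewrite inE.
have /colP/(_ (enum_rank_in iJ i)) := x0.
by rewrite !mxE /f enum_rankK_in // => /eqP; rewrite (negPf zi).
Qed.

(** Extension by zero turns a vector reversed by the submatrix into one reversed by [M]. *)
Lemma no_sign_reversal_mxsub n k (M : 'M[R]_n) (f : 'I_k -> 'I_n) :
  injective f -> no_sign_reversal M -> no_sign_reversal (mxsub f f M).
Proof.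
move=> fI nsr x xM.
pose z : 'cV_n := \col_i \sum_k x k 0 * (i == f k)%:R.
have zf j : z (f j) 0 = x j 0.
  rewrite mxE (bigD1 j) //= eqxx mulr1 big1 ?addr0 // => l lj.
  by rewrite (inj_eq fI) eq_sym (negPf lj) mulr0.
have MzE j : (M *m z) (f j) 0 = (mxsub f f M *m x) j 0.
  rewrite !mxE; under eq_bigr do rewrite mxE mulr_sumr.
  rewrite exchange_big /=; apply: eq_bigr => l _.
  rewrite (bigD1 (f l)) //= eqxx big1 ?addr0 ?mulr1 ?mxE // => i /negPf ->.
  by rewrite !mulr0.
have z0 : z = 0.
  apply: nsr => i; have [/codomP[j ->]|nfi] := boolP (i \in codom f).
    by rewrite zf MzE.
  rewrite mxE big1 ?mul0r // => l _.
  by case: eqP nfi => [-> |]; rewrite ?codom_f ?mulr0.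
by apply/colP=> j; rewrite -zf z0 !mxE.
Qed.

(* The segment from the identity to [M] avoids singular matrices. *)
Lemma no_sign_reversal_det n (M : 'M[R]_n) : no_sign_reversal M -> 0 < \det M.
Proof.
move=> nsr.
pose H : 'M[{poly R}]_n := 'X *: map_mx polyC M + (1 - 'X)%:M.
have HE t : (\det H).[t] = \det (t *: M + (1 - t)%:M).
  rewrite -[LHS]/(horner_eval t (\det H)) -det_map_mx; congr (\det _).
  apply/matrixP=> i j; rewrite !mxE /= /horner_eval.
  by rewrite hornerD hornerM hornerMn hornerD hornerN hornerX !hornerC.
have Hn0 t : 0 <= t <= 1 -> (\det H).[t] != 0.
  (* A kernel vector at [t > 0] satisfies [t M x = - (1 - t) x], hence is reversed by [M]. *)
  move=> /andP[t0 t1]; rewrite HE; apply/det_neq0_ker => x.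
  rewrite mulmxDl -scalemxAl mul_scalar_mx => /colP Hx.
  have E i : t * (M *m x) i 0 = - (1 - t) * x i 0.
    by have := Hx i; rewrite [X in X = _]mxE [X in X + _]mxE [X in _ + X]mxE
      [X in _ = X]mxE => h; lra.
  have [t00 | tn0] := eqVneq t 0.
    by apply/colP=> i; rewrite [RHS]mxE; have := E i; rewrite t00 => h; lra.
  have tp : 0 < t by rewrite lt_def tn0.
  apply: nsr => i; rewrite -(pmulr_rle0 _ tp) mulrCA E.
  by have := sqr_ge0 (x i 0); nra.
rewrite ltNge; apply/negP => dM.
have H1 : (\det H).[1] = \det M.
  by rewrite HE scale1r subrr -scalemx1 scale0r addr0.
have H0 : (\det H).[0] = 1.
  by rewrite HE scale0r add0r subr0 det1.
(* [\det H] is [1] at [0], so a nonpositive [\det M] would force a root in between. *)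
have [t t01] : exists2 t, 0 <= t <= 1 & root (- \det H) t.
  by apply: poly_ivt => //; rewrite !hornerN H0 H1; lra.
by rewrite rootN => /rootP /eqP; rewrite (negPf (Hn0 _ t01)).
Qed.

Lemma P_matrixE n (M : 'M[R]_n) : P_matrix M <-> no_sign_reversal M.
Proof.
split=> [|nsr J]; first exact: P_matrix_no_sign_reversal.
by apply: no_sign_reversal_det; apply: no_sign_reversal_mxsub => //;
  apply: enum_val_inj.
Qed.
End Minors.

(** * Unique solvability of complementarity problems *)

Section LCP.
Variables (R : realType) (n : nat) (M : 'M[R]_n).
Implicit Types (q x z : 'cV[R]_n).

(** With slacks [v] of [x] and [w] of [y], complementarity gives [(x - y)_i (v - w)_i = - x_i w_i -
    y_i v_i <= 0]. *)
Lemma lcp_unique q x y :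
  no_sign_reversal M -> lcp M q x -> lcp M q y -> x = y.
Proof.
move=> nsr xP yP; apply/eqP; rewrite -subr_eq0; apply/eqP; apply: nsr => i.
have [x0 xq xc] := xP i; have [y0 yq yc] := yP i.
rewrite mulmxBr !mxE in xq xc yq yc *.
by nra.
Qed.

(* Indices in [K] are complementary, those in [A] have zero slack, and all
   others have zero effort; [K = setT] is the LCP. Moving an index [i] out of
   [K] either way gives two candidates, and if both violate their sign
   condition at [i], their difference is a sign reversal. *)
Lemma partial_lcp_exists q (K A : {set 'I_n}) : no_sign_reversal M ->
  [disjoint K & A] ->
  exists z, forall i,
    [/\ i \in K -> [/\ 0 <= z i 0, q i 0 <= (M *m z) i 0 &
                       z i 0 * ((M *m z) i 0 - q i 0) = 0],
        i \in A -> (M *m z) i 0 = q i 0 &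
        i \notin K :|: A -> z i 0 = 0].
Proof.
move=> nsr; have [k] := ubnP #|K|; elim: k K A => // k IH K A.
have [-> _ _ | [i iK] Kk KA] := set_0Vmem K.
  (* Rows in [A] come from [M], the others from the identity; a kernel vector of [B] is therefore
     reversed by [M]. *)
  pose B : 'M[R]_n := \matrix_(i, j) (if i \in A then M i j else (i == j)%:R).
  have BE z i : (B *m z) i 0 = if i \in A then (M *m z) i 0 else z i 0.
    rewrite !mxE; case: ifP => iA; first by under eq_bigr do rewrite mxE iA.
    rewrite (bigD1 i) //= mxE iA eqxx mul1r big1 ?addr0 // => j ji.
    by rewrite mxE iA eq_sym (negPf ji) mul0r.
  have Bu : B \in unitmx.
    rewrite unitmxE unitfE; apply/det_neq0_ker => z /colP Bz; apply: nsr => i.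
    have := Bz i; rewrite BE [RHS]mxE.
    by case: ifP => _ ->; rewrite ?mulr0 ?mul0r.
  pose p : 'cV_n := \col_i (if i \in A then q i 0 else 0).
  exists (invmx B *m p) => i.
  have := BE (invmx B *m p) i; rewrite mulKVmx // [LHS]mxE finset.set0U.
  by case: (i \in A) => /esym E; split; rewrite ?inE.
have KiK : (#|K :\ i| < k)%N.
  by move: Kk; rewrite (cardsD1 i K) iK add1n ltnS.
have iA : i \notin A by rewrite (disjointFr KA).
have KiA : [disjoint K :\ i & A].
  by apply: disjointWl KA; apply: subsetDl.
have KiiA : [disjoint K :\ i & i |: A].
  rewrite disjoint_subset; apply/fintype.subsetP => j; rewrite !inE negb_or.
  by case/andP=> -> /(disjointFr KA) ->.
have [x xP] := IH _ _ KiK KiA; have [y yP] := IH _ _ KiK KiiA.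
have xi0 : x i 0 = 0.
  by have [_ _ xN] := xP i; apply: xN; rewrite !inE eqxx (negPf iA).
have yi0 : (M *m y) i 0 = q i 0.
  by have [_ yA _] := yP i; apply: yA; rewrite !inE eqxx.
have [xiq | xiq] := leP (q i 0) ((M *m x) i 0).
  exists x => j; have [jK jA jN] := xP j; split=> //.
    have [-> _ | ji jinK] := eqVneq j i; first by rewrite xi0 mul0r.
    by apply: jK; rewrite !inE ji.
  move=> jKA; apply: jN; apply: contraNN jKA; rewrite !inE.
  by case: (j == i) => /=; [move=> ->; rewrite orbT|].
have [yi | yi] := leP 0 (y i 0).
  exists y => j; have [jK jA jN] := yP j; split=> //.
  - have [-> _ | ji jinK] := eqVneq j i; first by rewrite yi0 subrr mulr0.
    by apply: jK; rewrite !inE ji.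
  - by move=> jinA; apply: jA; rewrite !inE jinA orbT.
  - move=> jKA; apply: jN; move: jKA; rewrite !inE.
    by have [-> | //] := eqVneq j i; rewrite iK.
(* At [i] the difference is positive and its image negative; on [K :\ i] the computation for
   uniqueness applies; elsewhere one factor vanishes. *)
have xy0 : x - y = 0.
  apply: nsr => j; have [xK xA xN] := xP j; have [yK yA yN] := yP j.
  rewrite mulmxBr [(x - y) j 0]mxE [(M *m x - _) j 0]mxE.
  rewrite [(- y) j 0]mxE [(- (M *m y)) j 0]mxE.
  have [-> | ji] := eqVneq j i; first by rewrite xi0 yi0; nra.
  have [jK | jK] := boolP (j \in K :\ i).
    by have [x1 x2 x3] := xK jK; have [y1 y2 y3] := yK jK; nra.
  have [jA | jA] := boolP (j \in A).
    by rewrite xA // yA ?inE ?jA ?orbT // subrr mulr0.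
  have -> : x j 0 = 0 by apply: xN; rewrite finset.in_setU negb_or jK jA.
  have -> : y j 0 = 0.
    by apply: yN; rewrite finset.in_setU in_setU1 (negPf jK) (negPf ji).
  by rewrite subrr mul0r.
have : x i 0 = y i 0 by move/eqP: xy0; rewrite subr_eq0 => /eqP ->.
by move=> E; rewrite -E xi0 ltxx in yi.
Qed.

Lemma no_sign_reversal_lcp :
  no_sign_reversal M <-> forall q, exists! x, lcp M q x.
Proof.
split=> [nsr q | uniq z zM].
  have [|x xP] := @partial_lcp_exists q finset.setT finset.set0 nsr.
    by rewrite -setI_eq0 finset.setI0.
  have xl : lcp M q x.
    by move=> i; have [xK _ _] := xP i; apply: xK; rewrite inE.
  by exists x; split=> // y; apply: lcp_unique.
pose pos (v : 'cV[R]_n) : 'cV_n := \col_i Num.max (v i 0) 0.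
pose neg v := pos v - v.
have posE v i : pos v i 0 = Num.max (v i 0) 0 by rewrite mxE.
have negE v i : neg v i 0 = Num.max (v i 0) 0 - v i 0 by rewrite !mxE.
(* Since [M z = M z^+ - M z^-], this [q] belongs both to [z^+] with slack [(M z)^+] and to [z^-]
   with slack [(M z)^-]. *)
pose q := M *m pos z - pos (M *m z).
have qE : q = M *m neg z - neg (M *m z).
  by rewrite /neg mulmxBr opprB addrA subrK.
have sol (a b : 'cV_n) :
    (forall i, [/\ 0 <= a i 0, 0 <= b i 0 & a i 0 * b i 0 = 0]) ->
    lcp M (M *m a - b) a.
  move=> ab i; have [a0 b0 abi] := ab i.
  rewrite [(_ - b) i 0]mxE [(- b) i 0]mxE; split=> //; first by lra.
  by rewrite opprB addrC subrK.
have [x [_ xu]] := uniq q.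
(* Reversal makes [z_i^+ (M z)_i^+] vanish, and likewise the product of the negative parts. *)
have px : x = pos z.
  apply: xu; apply: sol => i; have := zM i.
  rewrite !posE /Num.max.
  by case: ltP => ?; case: ltP => ? ?; split; nra.
have nx : x = neg z.
  apply: xu; rewrite qE; apply: sol => i; have := zM i.
  rewrite !negE /Num.max.
  by case: ltP => ?; case: ltP => ? ?; split; nra.
have : neg z = pos z by rewrite -px -nx.
by move/eqP; rewrite /neg subr_eq addrC -subr_eq subrr eq_sym => /eqP.
Qed.
End LCP.

(** * Best-reply systems *)

Section Game.
Variable (R : realType).

(** The best reply says [min (x_i, x_i + (G x)_i - q_i) = 0], so effort and slack are
    complementary. *)
Lemma nash_equilibriumE n (G : 'M[R]_n) q x :
  nash_equilibrium G q x <-> lcp (1%:M + G) q x.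
Proof.
have E i : ((1%:M + G) *m x) i 0 = x i 0 + (G *m x) i 0.
  by rewrite mulmxDl mul1mx mxE.
have qGE i : (q - G *m x) i 0 = q i 0 - (G *m x) i 0.
  by rewrite [LHS]mxE [(- (G *m x)) i 0]mxE.
have BR : x = map2_mx Num.max 0 (q - G *m x) <->
    forall i, x i 0 = Num.max 0 (q i 0 - (G *m x) i 0).
  split=> [/colP xE i|xE]; last apply/colP=> i; rewrite {}xE.
    by rewrite [LHS]mxE [(0 : 'cV_n) i 0]mxE qGE.
  by rewrite [RHS]mxE [(0 : 'cV_n) i 0]mxE qGE.
split=> [[x0 /BR xE] i | xl].
  rewrite E; have := x0 i; have := xE i; rewrite /Num.max.
  by case: ltP => ? -> ?; split; nra.
split=> [i|]; first by have [] := xl i.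
apply/BR => i; have := xl i; rewrite E /Num.max => -[x0 xq /eqP].
by rewrite mulf_eq0 => /orP[] /eqP ?; case: ltP => ?; lra.
Qed.

(** Each layer sees the efforts of the other only as a shift of its own targets. *)
Lemma nash_equilibrium_block n m (A : 'M[R]_n) (B : 'M[R]_(n, m))
    (C : 'M[R]_(m, n)) (D : 'M[R]_m) q1 q2 x1 x2 :
  nash_equilibrium (block_mx A B C D) (col_mx q1 q2) (col_mx x1 x2) <->
  nash_equilibrium A (q1 - B *m x2) x1 /\ nash_equilibrium D (q2 - C *m x1) x2.
Proof.
have maxE k l (u v : 'cV[R]_k) (s t : 'cV[R]_l) :
    map2_mx Num.max (col_mx u s) (col_mx v t)
    = col_mx (map2_mx Num.max u v) (map2_mx Num.max s t).
  by apply/colP=> i; rewrite !mxE; case: splitP => j _; rewrite !mxE.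
rewrite /nash_equilibrium mul_block_col opp_col_mx add_col_mx -col_mx0 maxE.
rewrite [A *m x1 + _]addrC !opprD !addrA.
split=> [[x0 /eq_col_mx[x1E x2E]] | [[x10 <-] [x20 <-]]].
  split; split=> // i.
    by have := x0 (lshift m i); rewrite col_mxEu.
  by have := x0 (rshift n i); rewrite col_mxEd.
by split=> // i; rewrite mxE; case: splitP.
Qed.

(** * Benefit functions with prescribed targets *)

(** Away from the mean [m] the exponential lies strictly above its tangent line at [m], and the
    linear terms average out. *)
Lemma strictly_concave_opp_expR (q : R) :
  strictly_concave (fun t => - expR (q - t)).
Proof.
move=> s t a st a0 a1; set m := a * s + (1 - a) * t.
have mE : m = a * s + (1 - a) * t by [].
have expE u : expR (q - u) = expR (q - m) * expR (m - u).
  by rewrite -expRD; congr expR; lra.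
have tangent u : u != m -> 1 + (m - u) < expR (m - u).
  by move=> um; apply: expR_gt1Dx; rewrite subr_eq0 eq_sym.
have st0 : s - t != 0 by rewrite subr_eq0.
have sm : s != m.
  rewrite -subr_eq0 (_ : s - m = (1 - a) * (s - t)); last by lra.
  by rewrite mulf_neq0 //; lra.
have tm : t != m.
  rewrite -subr_eq0 (_ : t - m = - (a * (s - t))); last by lra.
  by rewrite oppr_eq0 mulf_neq0 //; lra.
rewrite (expE s) (expE t).
have := tangent s sm; have := tangent t tm; have := expR_gt0 (q - m).
move: (expR (q - m)) (expR (m - s)) (expR (m - t)) => e es et e0 tt ts.
have es' : a * (1 + (m - s)) < a * es by rewrite ltr_pM2l.
have et' : (1 - a) * (1 + (m - t)) < (1 - a) * et by rewrite ltr_pM2l //; lra.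
have lt1 : 1 < a * es + (1 - a) * et by lra.
by rewrite -(ltr_pM2l e0) in lt1; lra.
Qed.

Lemma target_surjective (q : R) :
  exists b c, admissible b c /\ target b c = q.
Proof.
pose b (t : R) : R := - expR (q - t).
have db t : is_derive t (1 : R) b (expR (q - t)).
  apply: is_derive_eq; rewrite /GRing.scale /=. ring.
have b'E : derive1 b = fun t => expR (q - t).
  by apply/funext => t; rewrite derive1E derive_val.
exists b, 1; split; last first.
  rewrite /target b'E; apply: xget_unique => /=.
    by rewrite subrr expR0.
  by move=> t /eqP; rewrite -expR0 => /eqP /expR_inj; lra.
split=> //.
- by split=> t; rewrite ?b'E.
- by move=> s t st; rewrite /b ltrN2 ltr_expR; lra.
- exact: strictly_concave_opp_expR.
- by exists q; rewrite b'E subrr expR0.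
Qed.

Lemma target_vector_surjective n (q : 'cV[R]_n) :
  exists b c, (forall i, admissible (b i) (c i)) /\ target_vector b c = q.
Proof.
have /choice[b bP] := fun i => target_surjective (q i 0).
have [c bcP] := choice bP.
exists b, c; split=> [i|]; first by case: (bcP i).
by apply/colP=> i; rewrite mxE; case: (bcP i).
Qed.

Lemma layer_guaranteed_unique_nashE n (G : 'M[R]_n) :
  layer_guaranteed_unique_nash G <->
  forall q, exists! x, nash_equilibrium G q x.
Proof.
split=> [H q | H b c _]; last exact: H.
by have [b [c [bc <-]]] := target_vector_surjective q; apply: H.
Qed.

Lemma multilayer_guaranteed_unique_nashE n (G1 G12 G21 G2 : 'M[R]_n) :
  multilayer_guaranteed_unique_nash G1 G12 G21 G2 <->
  forall q1 q2, exists! x,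
    nash_equilibrium (block_mx G1 G12 G21 G2) (col_mx q1 q2) x.
Proof.
split=> [H q1 q2 | H b1 b2 c1 c2 _ _]; last exact: H.
have [b1 [c1 [bc1 <-]]] := target_vector_surjective q1.
have [b2 [c2 [bc2 <-]]] := target_vector_surjective q2.
exact: H.
Qed.

(** * One-way coupling of the layers *)

(** Serves to silence a layer: with nonpositive targets, inactivity is a best reply to itself. *)
Lemma nash_equilibrium0 n (G : 'M[R]_n) (q : 'cV_n) :
  (forall i, q i 0 <= 0) -> nash_equilibrium G q 0.
Proof.
move=> q0; split=> [i|]; first by rewrite mxE.
apply/colP=> i; rewrite mulmx0 subr0 [RHS]mxE !mxE.
by rewrite max_l.
Qed.

(* Testing the follower [D] requires silencing the leader [A] (target 0), and
   uniqueness for the leader requires silencing the follower (very negative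
   target). *)
Lemma cascade_unique_nash n m (A : 'M[R]_n) (C : 'M[R]_(m, n)) (D : 'M[R]_m) :
  (forall q1 q2, exists! x : 'cV_n * 'cV_m,
     nash_equilibrium A q1 x.1 /\ nash_equilibrium D (q2 - C *m x.1) x.2) <->
  (forall q, exists! x, nash_equilibrium A q x) /\
  (forall q, exists! x, nash_equilibrium D q x).
Proof.
split=> [H | [HA HD] q1 q2]; last first.
  have [x1 [x1N x1u]] := HA q1; have [x2 [x2N x2u]] := HD (q2 - C *m x1).
  exists (x1, x2); split=> // -[y1 y2] /= [y1N y2N].
  by rewrite -(x1u _ y1N) in y2N *; rewrite -(x2u _ y2N).
have leader q x y : nash_equilibrium A q x -> nash_equilibrium A q y -> x = y.
  move=> xN yN.
  (* The minimum makes the follower's shifted targets nonpositive whether the leader plays [x] or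
     [y]. *)
  pose q2 : 'cV_m := \col_i Num.min ((C *m x) i 0) ((C *m y) i 0).
  have [z [_ zu]] := H q q2.
  have silent u : (forall i, q2 i 0 <= (C *m u) i 0) ->
      nash_equilibrium D (q2 - C *m u) 0.
    move=> le_q2; apply: nash_equilibrium0 => i.
    by rewrite [(q2 - _) i 0]mxE [(- (C *m u)) i 0]mxE subr_le0.
  have zx : z = (x, 0).
    by apply: zu; split=> //; apply: silent => i; rewrite mxE ge_min lexx.
  have zy : z = (y, 0).
    by apply: zu; split=> //; apply: silent => i; rewrite mxE ge_min lexx orbT.
  by move: zx; rewrite zy => -[].
split=> q.
  have [[x1 x2] [[x1N _] _]] := H q 0.
  by exists x1; split=> // y; apply: leader.
(* A leader with target zero stays at [0], so the follower's targets are not shifted. *)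
have A0 : nash_equilibrium A 0 0 by apply: nash_equilibrium0 => i; rewrite mxE.
have [[x1 x2] [[/= x1N x2N] xu]] := H 0 q.
have x10 : x1 = 0 := leader _ _ _ x1N A0.
subst x1; rewrite mulmx0 subr0 in x2N; exists x2; split=> // y yN.
have yP : nash_equilibrium A 0 0 /\ nash_equilibrium D (q - C *m 0) y.
  by rewrite mulmx0 subr0.
by have [] := xu (0, y) yP.
Qed.

(** Serves to pass between stacked effort vectors and pairs of layers. *)
Lemma unique_bij (S T : Type) (f : S -> T) (P : T -> Prop) (Q : S -> Prop) :
  bijective f -> (forall s, P (f s) <-> Q s) ->
  (exists! x, P x) <-> (exists! s, Q s).
Proof.
case=> g fK gK PQ; split=> [[x [Px xu]] | [s [Qs su]]].
  exists (g x); split=> [|s /PQ Ps]; first by apply/PQ; rewrite gK.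
  by rewrite (xu _ Ps) fK.
exists (f s); split=> [|x Px]; first exact/PQ.
by rewrite (su (g x)) ?gK //; apply/PQ; rewrite gK.
Qed.

Lemma one_way_unique_nash n (G1 G12 G21 G2 : 'M[R]_n) :
  G12 = 0 \/ G21 = 0 ->
  multilayer_guaranteed_unique_nash G1 G12 G21 G2 <->
  layer_guaranteed_unique_nash G1 /\ layer_guaranteed_unique_nash G2.
Proof.
rewrite multilayer_guaranteed_unique_nashE !layer_guaranteed_unique_nashE.
have col_bij : bijective (fun x : 'cV[R]_n * 'cV_n => col_mx x.1 x.2).
  exists (fun x => (usubmx x, dsubmx x)) => [[x1 x2]|x] /=.
    by rewrite col_mxKu col_mxKd.
  by rewrite vsubmxK.
have swap_bij : bijective (fun x : 'cV[R]_n * 'cV_n => col_mx x.2 x.1).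
  exists (fun x => (dsubmx x, usubmx x)) => [[x1 x2]|x] /=.
    by rewrite col_mxKu col_mxKd.
  by rewrite vsubmxK.
case=> ->.
  rewrite -(cascade_unique_nash G1 G21 G2).
  have E q1 q2 : (exists! x, nash_equilibrium (block_mx G1 0 G21 G2)
      (col_mx q1 q2) x) <-> (exists! x : 'cV_n * 'cV_n,
      nash_equilibrium G1 q1 x.1 /\ nash_equilibrium G2 (q2 - G21 *m x.1) x.2).
    apply: (unique_bij col_bij) => -[x1 x2].
    by rewrite nash_equilibrium_block mul0mx subr0.
  by split=> H q1 q2; apply/E; apply: H.
(* Here layer 2 leads, so the two blocks change places. *)
rewrite [_ /\ _]and_comm -(cascade_unique_nash G2 G12 G1).
have E q1 q2 : (exists! x, nash_equilibrium (block_mx G1 G12 0 G2)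
    (col_mx q1 q2) x) <-> (exists! x : 'cV_n * 'cV_n,
    nash_equilibrium G2 q2 x.1 /\ nash_equilibrium G1 (q1 - G12 *m x.1) x.2).
  apply: (unique_bij swap_bij) => -[x2 x1].
  by rewrite nash_equilibrium_block mul0mx subr0 and_comm.
by split=> H q1 q2; apply/E; apply: H.
Qed.

Lemma layer_guaranteed_P_matrix n (G : 'M[R]_n) :
  layer_guaranteed_unique_nash G <-> P_matrix (1%:M + G).
Proof.
rewrite layer_guaranteed_unique_nashE P_matrixE no_sign_reversal_lcp.
split=> H q; have [x [xN xu]] := H q; exists x; split;
  by [apply/nash_equilibriumE | move=> y /nash_equilibriumE /xu].
Qed.
End Game.

Theorem proposition6 (R : realType) (N : nat) (G1 G2 G12 G21 : 'M[R]_N)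
    (diag1 : forall i, G1 i i = 0) (diag2 : forall i, G2 i i = 0)
    (one_way : G12 = 0 \/ G21 = 0) :
  (multilayer_guaranteed_unique_nash G1 G12 G21 G2 <->
     layer_guaranteed_unique_nash G1 /\ layer_guaranteed_unique_nash G2) /\
  (multilayer_guaranteed_unique_nash G1 G12 G21 G2 <->
     P_matrix (1%:M + G1) /\ P_matrix (1%:M + G2)).
Proof.
have H := one_way_unique_nash G1 G2 one_way.
by split=> //; rewrite H !layer_guaranteed_P_matrix.
Qed.
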